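(* Let $r\ge 13$ be an integer. Then: (a) $F_v(2_r;r-10)\ge r+21$; moreover, if $R(10,3)>41$ and $r\ge 20$, then $F_v(2_r;r-10)=r+21$; (b) if $R(10,3)\le 41$, then $F_v(2_r;r-10)\ge r+22$, and $F_v(2_r;r-10)=r+22$ whenever $r\ge 21$.
   Context: All graphs are finite, simple and undirected. $\mathrm{cl}(G)$ is the clique number of $G$. $G\overset{v}{\to}(a_1,\dots,a_r)$ means: for every partition $V(G)=V_1\cup\dots\cup V_r$ into pairwise disjoint sets, some $V_i$ contains an $a_i$-clique. $H_v(a_1,\dots,a_r;q)$ is the set of graphs $G$ with $G\overset{v}{\to}(a_1,\dots,a_r)$ and $\mathrm{cl}(G)<q$, and $F_v(a_1,\dots,a_r;q)=\min\{|V(G)|:G\in H_v(a_1,\dots,a_r;q)\}$. $F_v(2_r;q)$ denotes $F_v(2,\dots,2;q)$ with $r$ twos. The Ramsey number $R(p,q)$ is the least $n$ such that every graph on at least $n$ vertices has a $p$-clique or an independent set of size $q$. *)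

(* Defs.v *)
From mathcomp Require Import all_boot.
Set Implicit Arguments. Unset Strict Implicit. Unset Printing Implicit Defensive.

Definition simple_graph (n : nat) (e : rel 'I_n) : Prop :=
  (forall x, ~~ e x x) /\ (forall x y, e x y = e y x).

Definition is_clique (n : nat) (e : rel 'I_n) (A : {set 'I_n}) : Prop :=
  forall x y, x \in A -> y \in A -> x != y -> e x y.

Definition is_indep (n : nat) (e : rel 'I_n) (A : {set 'I_n}) : Prop :=
  forall x y, x \in A -> y \in A -> x != y -> ~~ e x y.

Definition clique_lt (n : nat) (e : rel 'I_n) (q : nat) : Prop :=
  ~ (exists A : {set 'I_n}, #|A| = q /\ is_clique e A).

(* G -v-> (a_1,...,a_r), with a = [:: a_1; ...; a_r]. A partition
   V = V_1 u ... u V_r into pairwise disjoint (possibly empty) sets is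
   encoded by the map c sending each vertex to the index of its part. *)
Definition varrow (n : nat) (e : rel 'I_n) (a : seq nat) : Prop :=
  forall c : 'I_n -> 'I_(size a),
    exists i : 'I_(size a), exists A : {set 'I_n},
      [/\ (forall x, x \in A -> c x = i), #|A| = nth 0 a i & is_clique e A].

Definition inHv (n : nat) (e : rel 'I_n) (a : seq nat) (q : nat) : Prop :=
  [/\ simple_graph e, varrow e a & clique_lt e q].

(* F_v(a; q) >= m  (min over the empty set being +infinity) *)
Definition Fv_ge (a : seq nat) (q m : nat) : Prop :=
  forall (n : nat) (e : rel 'I_n), inHv e a q -> m <= n.

Definition Fv_eq (a : seq nat) (q m : nat) : Prop :=
  (exists e : rel 'I_m, inHv e a q) /\ Fv_ge a q m.

Definition ramsey_le (p q N : nat) : Prop :=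
  forall m : nat, N <= m -> forall e : rel 'I_m, simple_graph e ->
    (exists A : {set 'I_m}, #|A| = p /\ is_clique e A) \/
    (exists A : {set 'I_m}, #|A| = q /\ is_indep e A).

(* Main.v *)
Require Import Defs.
From mathcomp Require Import all_boot zify.
From Stdlib Require Import Classical.

Set Implicit Arguments.
Unset Strict Implicit.
Unset Printing Implicit Defensive.

(* The arrow G -> (2_r) means chi(G) > r, so one has to bound chi(G) - cl(G) by a
   function [gap] of m = |V(G)| - chi(G). If G has an independent 3-set, deleting
   it lowers m by at least 2 and chi by at most 1. Otherwise the complement H is
   triangle-free and m is its matching number nu. Deleting a vertex
   essential for nu, or splitting H along the classes of Gallai's lemma, reduces
   to |H| = 2 nu + 1, where the Ramsey bound R(3, nu+1-gap(nu)) <= 2 nu + 1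
   provides a large independent set of H, i.e. a clique of G. The bounds on
   R(3,k) for k <= 9, up to R(3,9) <= 37, follow from the Graver-Yackel edge
   counting inequality.

   Extremal graphs are joins of a complete graph with a graph on 41 (resp. 43)
   vertices without independent 3-sets and without 10-cliques (resp. 11-cliques);
   in the second case one takes the complement of a circulant graph on Z/43. *)

(** * Ramsey numbers R(3,k) *)

(* An entry (k, n, b, l) claims that a triangle-free graph on at least n vertices
   without independent k-set has degree sum at least b; b = 1000 stands for
   "no such graph on n vertices", that is R(3,k) <= n. The claim follows from the
   older entries for k-1 (listed later) by [graver_yackel] with multiplier l. The
   bounds and multipliers come from linear programming. *)
Notation entry := (nat * nat * nat * nat)%type.

(** An entry for [n'] vertices also serves larger sets, since degree sums grow with the set; the
    default 0 is the trivial bound. *)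
Definition best_bound (c : seq entry) k m :=
  foldr (fun (e : entry) b => let: (k', n', b', _) := e in
           if (k' == k) && (n' <= m) then maxn b' b else b) 0 c.

(** [d] runs over the possible degrees of a vertex and [m] counts its non-neighbours; degrees with
    [b' > m * k'] cannot occur. Degree sums are even, so exceeding [b - 2] means reaching [b];
    exceeding the maximum [n * k'.+1] is absurd, which is how [b = 1000] certifies non-existence. *)
Definition entry_ok (c : seq entry) (e : entry) :=
  let: (k, n, b, l) := e in
  if k is k'.+2 then
    [&& 0 < n, ~~ odd b &
     all (fun d => let m := n.-1 - d in let b' := best_bound c k'.+1 m in
            (b' <= m * k') ==>
            (n * n * d + l * minn (b - 2) (n * k'.+1)
             < n * (b' + 2 * d ^ 2 + l * d)))
         (iota 0 (minn k n))]
  else (k == 1) && (0 < n).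

Fixpoint certified (c : seq entry) :=
  if c is e :: c' then entry_ok c' e && certified c' else true.

Definition ramsey_cert : seq entry :=
  [:: (9, 37, 1000, 0); (8, 30, 1000, 0); (8, 28, 170, 15);
  (7, 24, 1000, 0); (7, 22, 114, 12); (7, 21, 98, 15); (7, 20, 84, 18);
  (6, 19, 1000, 0); (6, 17, 74, 7); (6, 16, 62, 10); (6, 15, 50, 14);
  (6, 14, 34, 15); (6, 13, 14, 11);
  (5, 14, 1000, 0); (5, 13, 46, 1); (5, 12, 40, 5); (5, 11, 30, 9); (5, 10, 18, 9);
  (4, 9, 1000, 0); (4, 8, 20, 6); (4, 7, 12, 8);
  (3, 6, 1000, 0); (3, 5, 10, 6); (3, 4, 2, 3); (2, 3, 1000, 0); (1, 1, 1000, 0)].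

Lemma ramsey_certified : certified ramsey_cert.
Proof. by vm_compute. Qed.

Lemma subset_of_card (T : finType) (S : {set T}) n :
  n <= #|S| -> exists2 S' : {set T}, S' \subset S & #|S'| = n.
Proof.
move=> le_n; have us : uniq (take n (enum S)) by rewrite take_uniq ?enum_uniq.
exists [set x in take n (enum S)].
  by apply/subsetP => x; rewrite inE => /mem_take; rewrite mem_enum.
by rewrite cardsE (card_uniqP us) size_takel // -cardE.
Qed.

(** * Degree sums of triangle-free graphs *)

Section TriangleFree.

Variables (T : finType) (h : rel T).
Implicit Types (S A : {set T}) (x y z v : T) (k n : nat).

Definition stable A := [forall x in A, forall y in A, ~~ h x y].

Lemma stableP A :
  reflect (forall x y, x \in A -> y \in A -> ~~ h x y) (stable A).
Proof.
apply: (iffP forall_inP) => [hA x y xA yA|hA x xA].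
  by move/forall_inP: (hA x xA); apply.
by apply/forall_inP => y yA; apply: hA.
Qed.

Definition alpha_lt S k := forall A, A \subset S -> stable A -> #|A| < k.

Definition nbrs S x := [set y in S | h x y].
Definition non_nbrs S x := [set y in S | (y != x) && ~~ h x y].
Definition degsum S := \sum_(x in S) #|nbrs S x|.

Hypothesis h_sym : symmetric h.
Hypothesis h_irr : irreflexive h.
Hypothesis h_tri : forall x y z, h x y -> h x z -> ~~ h y z.

Lemma alpha_ltS S S' k : S' \subset S -> alpha_lt S k -> alpha_lt S' k.
Proof. by move=> sS aS A sA; apply: aS; apply: subset_trans sS. Qed.

Lemma card_nbrs_lt S x k : alpha_lt S k -> #|nbrs S x| < k.
Proof.
apply; first by apply/subsetP => y; rewrite inE => /andP[].
by apply/stableP => y z; rewrite !inE => /andP[_ xy] /andP[_ xz]; apply: h_tri xz.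
Qed.

(** [x] extends every stable set of its non-neighbours. *)
Lemma alpha_lt_non_nbrs S x k :
  x \in S -> alpha_lt S k.+1 -> alpha_lt (non_nbrs S x) k.
Proof.
move=> xS aS A sA stA; have xA : x \notin A.
  by apply/negP => /(subsetP sA); rewrite inE eqxx andbF.
have := aS (x |: A); rewrite cardsU1 xA add1n ltnS; apply.
  rewrite subUset sub1set xS; apply: subset_trans sA _.
  by apply/subsetP => y; rewrite inE => /andP[].
have xN y : y \in A -> ~~ h x y.
  by move/(subsetP sA); rewrite inE => /and3P[].
apply/stableP => y z; rewrite !inE.
move=> /predU1P[->|yA] /predU1P[->|zA]; rewrite ?h_irr ?xN //.
  by rewrite h_sym xN.
by apply: (stableP _ stA).
Qed.

Lemma card_non_nbrs S x :
  x \in S -> #|non_nbrs S x| = #|S|.-1 - #|nbrs S x|.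
Proof.
move=> xS; have -> : non_nbrs S x = (S :\ x) :\: nbrs S x.
  by apply/setP => y; rewrite !inE; case: (y \in S); rewrite ?andbF //= andbT andbC.
have /setIidPr sN : nbrs S x \subset S :\ x.
  apply/subsetP => y; rewrite !inE => /andP[-> xy]; rewrite andbT.
  by apply: contraTneq xy => ->; rewrite h_irr.
by rewrite cardsD sN (cardsD1 x S) xS.
Qed.

Lemma degsumE S : degsum S = \sum_(x in S) \sum_(y in S) h x y.
Proof.
apply: eq_bigr => x _; rewrite -sum1_card (eq_bigl (fun y => (y \in S) && h x y)).
  by rewrite big_mkcondr; apply: eq_bigr => y _; case: (h x y).
by move=> y; rewrite inE.
Qed.

Lemma degsumD1 S x :
  x \in S -> degsum S = degsum (S :\ x) + 2 * #|nbrs S x|.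
Proof.
move=> xS; have dx : #|nbrs S x| = \sum_(y in S :\ x) h x y.
  rewrite -sum1_card (eq_bigl (fun y => (y \in S :\ x) && h x y)).
    by rewrite big_mkcondr; apply: eq_bigr => y _; case: (h x y).
  by move=> y; rewrite !inE; case: eqP => [->|]; rewrite ?h_irr ?andbF.
rewrite !degsumE (big_setD1 x xS) /= (big_setD1 x xS) /= h_irr add0n -dx.
under eq_bigr => y _ do rewrite (big_setD1 x xS) h_sym /=.
by rewrite big_split /= -dx; lia.
Qed.

Lemma degsum_subset S S' : S' \subset S -> degsum S' <= degsum S.
Proof.
move=> sS; rewrite !degsumE [leqRHS](big_setID S') /=.
rewrite (setIidPr sS); apply: leq_trans (leq_addr _ _).
apply: leq_sum => x _; rewrite [leqRHS](big_setID S') /= (setIidPr sS).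
exact: leq_addr.
Qed.

Lemma degsum_even S : ~~ odd (degsum S).
Proof.
have [n] := ubnP #|S|; elim: n S => // n IHn S leS.
have [->|[x xS]] := set_0Vmem S; first by rewrite /degsum big_set0.
rewrite (degsumD1 xS) oddD oddM /= addbF; apply: IHn.
by rewrite (cardsD1 x) xS in leS.
Qed.

Lemma degsum_le S k : alpha_lt S k.+1 -> degsum S <= #|S| * k.
Proof.
by move=> aS; rewrite -sum_nat_const; apply: leq_sum => x _; rewrite -ltnS card_nbrs_lt.
Qed.

(* An edge xy survives in the non-neighbourhood of exactly the v outside the
   disjoint sets N(x) and N(y). *)
Lemma sum_degsum_non_nbrs S :
  \sum_(v in S) degsum (non_nbrs S v) + 2 * \sum_(v in S) #|nbrs S v| ^ 2
  = #|S| * degsum S.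
Proof.
have cn v : #|nbrs S v| = \sum_(x in S) h v x.
  rewrite -sum1_card (eq_bigl (fun y => (y \in S) && h v y)).
    by rewrite big_mkcondr; apply: eq_bigr => y _; case: (h v y).
  by move=> y; rewrite inE.
have sq v : #|nbrs S v| ^ 2 = \sum_(x in S) \sum_(y in S) h v x * h v y.
  by rewrite -mulnn !cn big_distrl /=; apply: eq_bigr => x _; rewrite big_distrr.
have nn v : v \in S -> degsum (non_nbrs S v)
  = \sum_(x in S) \sum_(y in S) (h x y && (~~ h v x && ~~ h v y)).
  move=> vS; rewrite degsumE.
  have tr (F : T -> nat) : \sum_(x in non_nbrs S v) F x
     = \sum_(x in S) ((x != v) && ~~ h v x) * F x.
    rewrite (eq_bigl (fun y => (y \in S) && ((y != v) && ~~ h v y))).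
      by rewrite big_mkcondr; apply: eq_bigr => y _; case: (_ && _); rewrite ?mul1n.
    by move=> y; rewrite inE.
  rewrite tr; apply: eq_bigr => x _; rewrite tr big_distrr; apply: eq_bigr => y _ /=.
  case: (x =P v) => [->|_]; case: (y =P v) => [->|_] /=; rewrite ?h_irr //=.
  - by case: (h v y).
  - by rewrite (h_sym x v); case: (h v x).
  - by case: (h x y) => /=; rewrite ?muln0 // mulnA muln1 mulnb.
have e1 : \sum_(v in S) #|nbrs S v| ^ 2
  = \sum_(v in S) \sum_(x in S) \sum_(y in S) (h x y && h v x).
  rewrite exchange_big; apply: eq_bigr => x _; rewrite sq.
  apply: eq_bigr => v _; apply: eq_bigr => y _.
  by rewrite mulnb andbC (h_sym v).
have e2 : \sum_(v in S) #|nbrs S v| ^ 2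
  = \sum_(v in S) \sum_(x in S) \sum_(y in S) (h x y && h v y).
  rewrite e1; apply: eq_bigr => v _; rewrite exchange_big.
  by apply: eq_bigr => x _; apply: eq_bigr => y _; rewrite h_sym.
rewrite mul2n -addnn {1}e1 e2 (eq_bigr _ nn) -sum_nat_const degsumE.
rewrite addnA -!big_split; apply: eq_bigr => v _ /=.
rewrite -!big_split; apply: eq_bigr => x _ /=.
rewrite -!big_split; apply: eq_bigr => y _ /=.
case xy: (h x y) => //=; case vx: (h v x); case vy: (h v y) => //=.
by have := h_tri vx vy; rewrite xy.
Qed.

(** An averaging argument: if [degsum S <= s], the assumed inequality at d = deg v, summed over all
    v and rewritten by [sum_degsum_non_nbrs], reduces to [l * s < l * degsum S], a contradiction. So
    [l] is a Lagrange multiplier for the constraint on the degree sum. *)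
Lemma graver_yackel S k (B : nat -> nat) l s :
    alpha_lt S k.+2 ->
    (forall S', alpha_lt S' k.+1 -> B #|S'| <= degsum S') ->
    0 < #|S| ->
    (forall d, d <= k.+1 -> d < #|S| ->
       B (#|S|.-1 - d) <= (#|S|.-1 - d) * k ->
       #|S| * #|S| * d + l * s
       < #|S| * (B (#|S|.-1 - d) + 2 * d ^ 2 + l * d)) ->
  s < degsum S.
Proof.
move=> aS hB S0 hd; rewrite ltnNge; apply/negP => le_s.
have gy := sum_degsum_non_nbrs S.
set n := #|S| in S0 hd gy *.
have pt v : v \in S -> n * n * #|nbrs S v| + l * s <
    n * (degsum (non_nbrs S v) + 2 * #|nbrs S v| ^ 2 + l * #|nbrs S v|).
  move=> vS; have av := alpha_lt_non_nbrs vS aS.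
  have Bv := hB _ av; rewrite card_non_nbrs // in Bv.
  have dn : #|nbrs S v| < n.
    rewrite /n (cardsD1 v S) vS ltnS; apply: subset_leq_card.
    apply/subsetP => y; rewrite !inE => /andP[-> xy]; rewrite andbT.
    by apply: contraTneq xy => ->; rewrite h_irr.
  have := degsum_le av; rewrite card_non_nbrs // => dv.
  have := hd _ (card_nbrs_lt v aS) dn (leq_trans Bv dv).
  move=> lt_d; apply: leq_trans lt_d _.
  by rewrite leq_mul2l !leq_add2r Bv orbT.
have : \sum_(v in S) (n * n * #|nbrs S v| + l * s) <
   \sum_(v in S) n * (degsum (non_nbrs S v) + 2 * #|nbrs S v| ^ 2 + l * #|nbrs S v|).
  have [v vS] : exists v, v \in S by apply/set0Pn; rewrite -card_gt0.
  rewrite (big_setD1 v vS) [ltnRHS](big_setD1 v vS) /=.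
  rewrite -addSn; apply: leq_add (pt v vS) _.
  by apply: leq_sum => x; rewrite in_setD1 => /andP[_] /pt /ltnW.
have -> : \sum_(v in S) (n * n * #|nbrs S v| + l * s)
    = n * n * degsum S + n * (l * s).
  by rewrite big_split /= sum_nat_const big_distrr.
have -> : \sum_(v in S) n * (degsum (non_nbrs S v) + 2 * #|nbrs S v| ^ 2
      + l * #|nbrs S v|) = n * (n * degsum S + l * degsum S).
  rewrite -[n * degsum S]gy /degsum !big_distrr /= -!big_split big_distrr /=.
  by apply: eq_bigr.
have : l * degsum S <= l * s by rewrite leq_mul2l le_s orbT.
by nia.
Qed.

Definition degsum_ge k n b := forall S, n <= #|S| -> alpha_lt S k -> b <= degsum S.

Lemma degsum_geW k n b :
  (forall S, #|S| = n -> alpha_lt S k -> b <= degsum S) -> degsum_ge k n b.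
Proof.
move=> hn S le_n aS.
have [S' sS' cS'] := subset_of_card le_n.
apply: leq_trans (degsum_subset sS'); apply: hn => //.
exact: alpha_ltS aS.
Qed.

Lemma alpha_lt1 S : alpha_lt S 1 -> #|S| = 0.
Proof.
move=> aS; apply/eqP; rewrite cards_eq0; apply/set0Pn => -[x xS].
have := aS [set x]; rewrite cards1 sub1set => /(_ xS).
case/(_ _)/negP => //; apply/stableP => y z.
by rewrite !inE => /eqP-> /eqP->; rewrite h_irr.
Qed.

Lemma certified_degsum_ge c :
  certified c -> forall e, e \in c -> degsum_ge e.1.1.1 e.1.1.2 e.1.2.
Proof.
elim: c => [//|[[[k n] b] l] c IHc] /= /andP[ok /IHc {}IHc] e.
rewrite inE => /predU1P[-> /=|]; last exact: IHc.
case: k ok => [|[|k]] //= ok.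
  by apply: degsum_geW => S cS /alpha_lt1; move: ok; rewrite cS => /[swap]->.
have best_ok S : alpha_lt S k.+1 -> best_bound c k.+1 #|S| <= degsum S.
  move=> aS; elim: c IHc {ok} => [//|[[[k' n'] b'] l'] c IH] hc /=.
  have {}IH : best_bound c k.+1 #|S| <= degsum S.
    by apply: IH => e' ec; apply: hc; rewrite inE ec orbT.
  case: ifP => // /andP[/eqP ek len]; rewrite geq_max IH andbT.
  have := hc (k', n', b', l') (mem_head _ _) S len; apply.
  by rewrite ek.
case/and3P: ok => n0 evb /allP ok.
apply: degsum_geW => S cS aS.
set s0 := minn (b - 2) (n * k.+1) in ok.
have lt_s0 : s0 < degsum S.
  apply: (graver_yackel (B := best_bound c k.+1) (l := l) aS) => //.
    by rewrite cS.
  rewrite cS => d dk dn; have := ok d; rewrite mem_iota /= add0n.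
  by rewrite leq_min ltnS dk dn => /(_ isT)/implyP; apply.
have := degsum_le aS; have := degsum_even S; rewrite cS.
by lia.
Qed.

End TriangleFree.

(** * Matchings *)

Section Matching.

Variables (T : finType) (h : rel T).
Implicit Types (S A : {set T}) (f g : {ffun T -> T}) (x y z u v w : T).

(* A matching is encoded by the involution exchanging the ends of its edges. *)
Definition matching S f :=
  [forall x, (f (f x) == x) && ((f x == x) || (x \in S) && h x (f x))].
Definition covered f := [set x | f x != x].
Definition nu S := \max_(f | matching S f) #|covered f|./2.

Definition add_pair f x y :=
  [ffun z => if z == x then y else if z == y then x else f z].
Definition drop_pair f y :=
  [ffun z => if (z == y) || (z == f y) then z else f z].

Hypothesis h_sym : symmetric h.
Hypothesis h_irr : irreflexive h.

Lemma matchingP S f :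
  reflect (involutive f /\ forall x, f x != x -> x \in S /\ h x (f x))
          (matching S f).
Proof.
apply: (iffP forallP) => [hf|[inv hf] x].
  split=> [x|x fx]; first by have /andP[/eqP] := hf x.
  by have /andP[_] := hf x; rewrite (negPf fx) => /andP.
by rewrite inv eqxx /=; case: eqVneq => //= /hf[-> ->].
Qed.

Lemma matching_inv S f : matching S f -> involutive f.
Proof. by case/matchingP. Qed.

Lemma matching_edge S f x : matching S f -> f x != x -> x \in S /\ h x (f x).
Proof. by case/matchingP => _; apply. Qed.

Lemma matching_in S f x : matching S f -> f x != x -> f x \in S.
Proof.
move=> mf fx; have [] := @matching_edge S f (f x) mf; last by [].
by rewrite (matching_inv mf) eq_sym.
Qed.

Lemma matching_subset S S' f : S' \subset S -> matching S' f -> matching S f.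
Proof.
move=> /subsetP sS mf; apply/matchingP; split; first exact: matching_inv mf.
by move=> x /(matching_edge mf)[/sS].
Qed.

Lemma matching_restrict S S' f :
  matching S f -> (forall x, f x != x -> x \in S') -> matching S' f.
Proof.
move=> mf hS; apply/matchingP; split; first exact: matching_inv mf.
by move=> x fx; have [_ ->] := matching_edge mf fx; split=> //; apply: hS.
Qed.

Lemma matching_setD1 S f x : matching S f -> f x = x -> matching (S :\ x) f.
Proof.
move=> mf fx; apply: (matching_restrict mf) => y fy; rewrite in_setD1.
have [-> _] := matching_edge mf fy; rewrite andbT.
by apply: contraNneq fy => ->; rewrite fx.
Qed.

Lemma matching_setD1_fix S f x : matching (S :\ x) f -> f x = x.
Proof.
move=> mf; apply/eqP; apply/idP/negPn/negP => /(matching_edge mf)[].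
by rewrite in_setD1 eqxx.
Qed.

Lemma matching_add S f x y :
    matching S f -> x \in S -> y \in S -> h x y -> f x = x -> f y = y ->
  matching S (add_pair f x y).
Proof.
move=> mf xS yS xy fx fy.
have nxy : y != x by apply: contraTneq xy => ->; rewrite h_irr.
apply/matchingP; split=> z; rewrite !ffunE.
  case: (z =P x) => [->|/eqP zx]; first by rewrite (negPf nxy) eqxx.
  case: (z =P y) => [->|/eqP zy]; first by rewrite eqxx.
  have -> : f z == x = false.
    by apply: contraNF zx => /eqP e; rewrite -(matching_inv mf z) e fx.
  have -> : f z == y = false.
    by apply: contraNF zy => /eqP e; rewrite -(matching_inv mf z) e fy.
  exact: matching_inv mf z.
case: (z =P x) => [->|/eqP zx] //; case: (z =P y) => [->|/eqP zy] //.
  by rewrite h_sym.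
exact: matching_edge.
Qed.

Lemma covered_add f x y :
  x != y -> covered (add_pair f x y) = x |: (y |: covered f).
Proof.
move=> nxy; apply/setP => z; rewrite !inE ffunE.
case: (z =P x) => [->|_] /=; first by rewrite eq_sym.
by case: (z =P y) => [->|_].
Qed.

Lemma matching_drop S f y : matching S f -> matching S (drop_pair f y).
Proof.
move=> mf; apply/matchingP; split=> z; rewrite !ffunE; last first.
  by case: ifP => [_|_]; [rewrite eqxx | apply: matching_edge].
case E: ((z == y) || (z == f y)); first by rewrite E.
move/norP: (negbT E) => [zy zfy]; case: ifP => [/orP[]/eqP e|_].
- by rewrite -e (matching_inv mf) eqxx in zfy.
- by rewrite -(matching_inv mf z) e (matching_inv mf) eqxx in zy.
- exact: matching_inv mf z.
Qed.

Lemma covered_drop f y : covered (drop_pair f y) = covered f :\ y :\ f y.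
Proof.
apply/setP => z; rewrite !inE ffunE.
by case: (z == y); case: (z == f y); rewrite /= ?eqxx ?andbF.
Qed.

Lemma card_covered_drop S f y :
  matching S f -> f y != y -> #|covered f| = #|covered (drop_pair f y)| + 2.
Proof.
move=> mf fy; rewrite covered_drop (cardsD1 y) inE fy (cardsD1 (f y)).
by rewrite !inE fy (matching_inv mf) eq_sym fy /=; lia.
Qed.

Lemma covered_even S f : matching S f -> ~~ odd #|covered f|.
Proof.
have [n] := ubnP #|covered f|; elim: n f => // n IHn f le_n mf.
have [->|[y]] := set_0Vmem (covered f); first by rewrite cards0.
rewrite inE => fy; have e := card_covered_drop mf fy.
by rewrite e oddD addbF; apply: IHn (matching_drop y mf); lia.
Qed.

Lemma matching_le_nu S f : matching S f -> #|covered f| <= 2 * nu S.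
Proof.
move=> mf; have := @leq_bigmax_cond _ (matching S) (fun g => #|covered g|./2) f mf.
rewrite -/(nu S); have := covered_even mf; lia.
Qed.

Lemma nu_attained S : exists2 f, matching S f & #|covered f| = 2 * nu S.
Proof.
have h0 : matching S [ffun x => x].
  by apply/matchingP; split=> x; rewrite !ffunE ?eqxx.
have [|f mf e] := @eq_bigmax_cond _ (matching S) (fun f => #|covered f|./2).
  by apply/card_gt0P; exists [ffun x => x].
exists f => //; have -> : nu S = #|covered f|./2 by rewrite -e.
by have := covered_even mf; lia.
Qed.

Lemma nu_subset S S' : S' \subset S -> nu S' <= nu S.
Proof.
move=> sS; have [f mf e] := nu_attained S'.
by have := matching_le_nu (matching_subset sS mf); lia.
Qed.

Lemma nu_card S : 2 * nu S <= #|S|.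
Proof.
have [f mf <-] := nu_attained S; apply: subset_leq_card; apply/subsetP => x.
by rewrite inE => /(matching_edge mf)[].
Qed.

(** A matching missing both ends of an edge can take that edge in. This places adjacent vertices in
    the same Gallai class. *)
Lemma nu_pair S x y :
  x \in S -> y \in S -> h x y -> nu (S :\ x :\ y) < nu S.
Proof.
move=> xS yS xy; have [f mf e] := nu_attained (S :\ x :\ y).
have nxy : x != y by apply: contraTneq xy => ->; rewrite h_irr.
have sS : S :\ x :\ y \subset S by rewrite setDDl subsetDl.
have fy := matching_setD1_fix mf.
have fx : f x = x.
  apply: (@matching_setD1_fix S); apply: matching_subset mf.
  exact: subsetDl.
have := matching_le_nu (matching_add (matching_subset sS mf) xS yS xy fx fy).
rewrite covered_add // !cardsU1 !inE fx fy eqxx (negPf nxy) /=; lia.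
Qed.

Lemma nu_disjoint S S' : [disjoint S & S'] -> nu S + nu S' <= nu (S :|: S').
Proof.
move=> dS; have [f mf ef] := nu_attained S; have [g mg eg] := nu_attained S'.
have fix_f x : x \in S' -> f x = x.
  move=> xS; apply/eqP; apply/idP/negPn/negP => /(matching_edge mf)[xS' _].
  by rewrite (disjointFr dS xS') in xS.
have fix_g x : x \in S -> g x = x.
  move=> xS; apply/eqP; apply/idP/negPn/negP => /(matching_edge mg)[xS' _].
  by rewrite (disjointFr dS xS) in xS'.
pose fg : {ffun T -> T} := [ffun x => if x \in S then f x else g x].
have mfg : matching (S :|: S') fg.
  apply/matchingP; split=> x; rewrite !ffunE.
    case xS : (x \in S).
      have [e|/(matching_in mf)->] := eqVneq (f x) x; first by rewrite !e xS.
      exact: matching_inv mf x.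
    have [e|gx] := eqVneq (g x) x; first by rewrite !e xS.
    by rewrite (disjointFl dS (matching_in mg gx)) (matching_inv mg).
  rewrite inE; case xS : (x \in S) => hx.
    by have [_ ->] := matching_edge mf hx.
  by have [-> ->] := matching_edge mg hx.
have cU : covered fg = covered f :|: covered g.
  apply/setP => x; rewrite !inE ffunE; case xS : (x \in S).
    by rewrite fix_g // eqxx orbF.
  suff -> : f x = x by rewrite eqxx.
  by apply/eqP; apply/idP/negPn/negP => /(matching_edge mf)[]; rewrite xS.
have := matching_le_nu mfg; rewrite cU cardsU.
suff -> : covered f :&: covered g = set0 by rewrite cards0; lia.
apply/setP => x; rewrite !inE; apply/negP => /andP[/(matching_edge mf)[xS _]].
by rewrite fix_g ?eqxx.
Qed.

(* Gallai's lemma, in the form: if no vertex is essential then "no maximum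
   matching misses both ends" is transitive. Among the maximum matchings missing
   the middle vertex w take one agreeing most with a maximum matching missing
   u and v; exchanging one pair improves the agreement. *)
Lemma gallai_trans S u v w :
    nu (S :\ w) = nu S -> w \in S -> u \in S -> v \in S -> u != v ->
    nu (S :\ u :\ w) < nu S -> nu (S :\ w :\ v) < nu S ->
  nu (S :\ u :\ v) < nu S.
Proof.
move=> ness wS uS vS nuv uw wv; rewrite ltnNge; apply/negP => le_uv.
have [f mf ef] := nu_attained (S :\ u :\ v).
have sS : S :\ u :\ v \subset S by rewrite setDDl subsetDl.
have fv := matching_setD1_fix mf.
have fu : f u = u.
  apply: (@matching_setD1_fix S); apply: matching_subset mf.
  exact: subsetDl.
have {}ef : #|covered f| = 2 * nu S by have := nu_subset sS; lia.
have {sS}mf : matching S f := matching_subset sS mf.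
pose agr g := #|[set x | (g x == f x) && (f x != x)]|.
pose good g := matching (S :\ w) g && (#|covered g| == 2 * nu S).
have [g0 mg0 eg0] := nu_attained (S :\ w).
have good0 : good g0 by rewrite /good mg0 eg0 ness eqxx.
case: (@arg_maxnP _ g0 good agr good0) => g /andP[mg /eqP eg] gmax.
have sw : S :\ w \subset S := subsetDl _ _.
have mgS := matching_subset sw mg.
have gw := matching_setD1_fix mg.
have gu : u \in covered g.
  rewrite inE; apply/negP => /eqP gu; have := matching_le_nu (matching_setD1 mg gu).
  by rewrite eg setDDl setUC -setDDl; move: uw; clear; lia.
have gv : v \in covered g.
  rewrite inE; apply/negP => /eqP gv; have := matching_le_nu (matching_setD1 mg gv).
  by rewrite eg; move: wv; clear; lia.
(* [f] and [g] cover equally many vertices and [g] alone covers [u] and [v], so [f] alone covers at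
   least two vertices, one of them not [w]. *)
have [x] : exists x, x \in (covered f :\: covered g) :\ w.
  apply/set0Pn; rewrite -card_gt0.
  have := cardsD1 w (covered f :\: covered g).
  have : 1 < #|covered g :\: covered f|.
    rewrite (cardsD1 u) (cardsD1 v) !inE fu fv !eqxx (eq_sym v) nuv /=.
    by move: gu gv; rewrite !inE => -> ->.
  have := cardsID (covered g) (covered f); have := cardsID (covered f) (covered g).
  by rewrite setIC ef eg; clear; lia.
rewrite !inE negbK => /and3P[xw /eqP gx fx].
have [xS xy] := matching_edge mf fx; have yS := matching_in mf fx.
set y := f x in xy yS; have fy : f y = x by apply: matching_inv mf x.
have nxy : x != y by rewrite eq_sym.
(* Otherwise adding the pair [x], [y] would enlarge the maximum matching [g]. *)
have gy : g y != y.
  apply/negP => /eqP gy; have := matching_le_nu (matching_add mgS xS yS xy gx gy).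
  by rewrite covered_add // !cardsU1 !inE gx gy !eqxx (negPf nxy) /= eg; clear; lia.
have yw : y != w by apply: contraNneq gy => ->; rewrite gw.
have zx : g y != x.
  by apply: contraNneq nxy => e; rewrite -gx -e (matching_inv mg).
(* Trading the pair [y], [g y] for [x], [y] keeps the size and still misses [w]. Agreement with [f]
   is gained at [x] and lost nowhere, because [f y = x] differs from [g y]. *)
pose g1 := drop_pair g y.
have m1 : matching (S :\ w) g1 := matching_drop y mg.
have g1x : g1 x = x by rewrite ffunE gx; case: ifP.
have g1y : g1 y = y by rewrite ffunE eqxx.
pose g2 := add_pair g1 x y.
have m2 : matching (S :\ w) g2.
  by apply: matching_add => //; rewrite !inE ?xw ?yw.
have c2 : #|covered g2| = 2 * nu S.
  rewrite covered_add // !cardsU1 !inE g1x g1y !eqxx (negPf nxy) /=.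
  by rewrite -eg (card_covered_drop mg gy) -/g1; clear; lia.
have good2 : good g2 by rewrite /good m2 c2 eqxx.
have : agr g2 <= agr g := gmax g2 good2.
rewrite leqNgt => /negP; apply.
apply: proper_card; apply/properP; split; last first.
  by exists x; rewrite !inE ?ffunE ?eqxx // gx eq_sym (negPf fx).
apply/subsetP => t; rewrite !inE !ffunE.
case: (t =P x) => [->|_]; first by rewrite gx eq_sym (negPf fx).
case: (t =P y) => [->|_]; first by rewrite fy (negPf zx).
case: (t =P g y) => //= -> /andP[/eqP e _].
by move: zx; rewrite -(matching_inv mf (g y)) -e (matching_inv mg) fy eqxx.
Qed.

End Matching.

(** * Chromatic number against clique number *)

Section StableLarge.

Variables (T : finType) (h : rel T) (g : nat -> nat) (M : nat).
Hypothesis h_sym : symmetric h.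
Hypothesis h_irr : irreflexive h.
Hypothesis g_superadd : forall a b, a + b <= M -> g a + g b <= g (a + b).
Hypothesis factor_critical_case : forall v (S : {set T}), v <= M ->
  #|S| = v.*2.+1 -> exists A : {set T}, [/\ A \subset S, stable h A & v < #|A| + g v].

Lemma superadd_mono a b : a <= b -> b <= M -> g a <= g b.
Proof.
move=> ab bM; have := @g_superadd a (b - a); rewrite subnKC // => /(_ bM).
exact: leq_trans (leq_addr _ _).
Qed.

Lemma stable_large (S : {set T}) : nu h S <= M ->
  exists A : {set T}, [/\ A \subset S, stable h A & #|S| <= nu h S + #|A| + g (nu h S)].
Proof.
have [n] := ubnP #|S|; elim: n S => // n IHn S le_n nuM.
have [/exists_inP[x xS ess]|/exists_inPn ness] :=
  boolP [exists x in S, nu h (S :\ x) < nu h S].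
  (* Deleting an essential vertex lowers [#|S|] by one and [nu] by at least one, so the bound for
     the rest carries over. *)
  have cS := cardsD1 x S; rewrite xS in cS.
  have [||A [sA stA leA]] := IHn (S :\ x); [by lia | by lia |].
  exists A; split=> //; first exact: subset_trans sA (subsetDl _ _).
  by have := superadd_mono (ltnW ess) nuM; lia.
have {}ness x : x \in S -> nu h (S :\ x) = nu h S.
  by move=> /ness; rewrite -leqNgt => le; have := nu_subset h (subsetDl S [set x]); lia.
have [S0|[x xS]] := set_0Vmem S.
  exists set0; split; rewrite ?sub0set ?S0 ?cards0 //.
  by apply/stableP => x y; rewrite inE.
(* As no vertex is essential, Gallai's lemma makes this an equivalence relation on [S]. *)
pose rel_nu y z := (y == z) || (nu h (S :\ y :\ z) < nu h S).
have rel_tr y z t : y \in S -> z \in S -> t \in S ->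
    rel_nu y z -> rel_nu z t -> rel_nu y t.
  move=> yS zS tS /predU1P[->//|yz] /predU1P[<-|zt]; first by rewrite /rel_nu yz orbT.
  rewrite /rel_nu; have [//|yt /=] := eqVneq y t.
  by apply: (@gallai_trans _ h _ _ S y t z) => //; apply: ness.
have rel_sym y z : rel_nu y z = rel_nu z y.
  by rewrite /rel_nu eq_sym !setDDl [[set z] :|: _]setUC.
pose C := [set y in S | rel_nu x y].
have sC : C \subset S by apply/subsetP => y; rewrite inE => /andP[].
have [CS|nCS] := eqVneq C S.
  have allrel y z : y \in S -> z \in S -> rel_nu y z.
    move=> yS zS; apply: (rel_tr y x z) => //.
      by move: yS; rewrite -{1}CS inE rel_sym => /andP[].
    by move: zS; rewrite -{1}CS inE => /andP[].
  have [f mf ef] := nu_attained h S.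
  have cov_S : covered f \subset S.
    by apply/subsetP => y; rewrite inE => /(matching_edge mf)[].
  (* A single class: a maximum matching misses at most one vertex, and at least one because deleting
     [x] keeps [nu]. *)
  have cS : #|S| = (nu h S).*2.+1.
    have lb : (nu h S).*2 <= #|S| - 1.
      have := nu_card h (S :\ x); rewrite ness // (cardsD1 x S) xS; lia.
    have S0 : 0 < #|S| by rewrite (cardsD1 x) xS.
    suff : #|S :\: covered f| <= 1.
      have := cardsID (covered f) S; rewrite (setIidPr cov_S) ef; lia.
    rewrite leqNgt; apply/negP => /card_gt1P[y [z []]].
    rewrite !inE !negbK => /andP[/eqP fy yS] /andP[/eqP fz zS] nyz.
    have := allrel y z yS zS; rewrite /rel_nu (negPf nyz) /=.
    have := matching_le_nu (matching_setD1 (matching_setD1 mf fy) fz).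
    by rewrite ef; lia.
  have [A [sA stA leA]] := factor_critical_case nuM cS.
  by exists A; split=> //; lia.
(* Several classes: edges stay within a class by [nu_pair], so the stable sets found in [C] and [D]
   have a stable union; [nu] and [g] are both superadditive. *)
pose D := S :\: C.
have cCD : #|C| + #|D| = #|S| by rewrite -{1}(setIidPr sC) cardsID.
have xC : x \in C by rewrite inE xS /rel_nu eqxx.
have C0 : 0 < #|C| by rewrite (cardsD1 x) xC.
have D0 : 0 < #|D|.
  rewrite card_gt0 setD_eq0; apply: contra nCS => sSC.
  by rewrite eqEsubset sC.
have dCD : [disjoint C & D] by rewrite -setI_eq0 setIDA setD_eq0 subsetIl.
have UCD : C :|: D = S by rewrite -[RHS](setID S C) (setIidPr sC).
have nuCD := nu_disjoint h dCD; rewrite UCD in nuCD.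
have [||A [sA stA leA]] := IHn C; [by lia | by lia |].
have [||B [sB stB leB]] := IHn D; [by lia | by lia |].
have no_edge y z : y \in A -> z \in B -> ~~ h y z.
  move=> /(subsetP sA); rewrite inE => /andP[yS xy].
  move=> /(subsetP sB); rewrite !inE => /andP[nz zS]; apply: contra nz => yz.
  rewrite zS; apply: (rel_tr x y z) => //.
  by rewrite /rel_nu (nu_pair h_sym h_irr) ?orbT.
exists (A :|: B); split.
- by rewrite -UCD setUSS.
- apply/stableP => y z; rewrite !inE.
  move=> /orP[yA|yB] /orP[zA|zB].
  + exact: (stableP _ _ stA).
  + exact: no_edge.
  + by rewrite h_sym no_edge.
  + exact: (stableP _ _ stB).
have dAB : A :&: B = set0.
  by apply/eqP; rewrite setI_eq0; apply: disjointWl sA (disjointWr sB dCD).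
rewrite cardsU dAB cards0 subn0.
have := @superadd_mono _ _ nuCD nuM.
have := @g_superadd (nu h C) (nu h D); lia.
Qed.

End StableLarge.

(** * Colourings and large cliques *)

Definition colorable (T : finType) (e : rel T) (S : {set T}) k :=
  exists2 c : T -> nat, forall x, x \in S -> c x < k &
    {in S &, forall x y, e x y -> c x != c y}.

Section Colorable.

Variables (T : finType) (e : rel T).
Hypothesis e_sym : symmetric e.
Hypothesis e_irr : irreflexive e.
Implicit Types S I A : {set T}.

Lemma colorable_leq S k k' : k <= k' -> colorable e S k -> colorable e S k'.
Proof. by move=> kk [c ck hc]; exists c => // x /ck /leq_trans; apply. Qed.

Lemma colorable_setD S I k :
  stable e I -> colorable e (S :\: I) k -> colorable e S k.+1.
Proof.
move=> /stableP stI [c ck hc]; exists (fun x => if x \in I then k else c x).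
  move=> x xS; case: ifPn => [//|xI]; apply: leqW; apply: ck.
  by rewrite inE xI.
move=> x y xS yS exy; case: ifPn => xI; case: ifPn => yI.
- by rewrite (negPf (stI _ _ xI yI)) in exy.
- by rewrite neq_ltn ck ?orbT // inE yI.
- by rewrite neq_ltn ck // inE xI.
by apply: hc; rewrite // inE ?xI ?yI.
Qed.

(** The two ends of a matching pair are non-adjacent in [e] and share a colour; every other vertex
    gets its own. *)
Lemma colorable_matching (h : rel T) S (f : {ffun T -> T}) :
    (forall x y, h x y -> ~~ e x y) -> matching h S f ->
  colorable e S (#|S| - #|covered f|./2).
Proof.
move=> he; have [n] := ubnP #|S|; elim: n S f => // n IHn S f le_n mf.
have [S0|[x xS]] := set_0Vmem S.
  by exists (fun=> 0) => x; rewrite S0 inE.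
have cS := cardsD1 x S; rewrite xS in cS.
have st1 : stable e [set x].
  by apply/stableP => y z; rewrite !inE => /eqP-> /eqP->; rewrite e_irr.
have [fx|fx] := eqVneq (f x) x.
  have mf' := matching_setD1 mf fx.
  have := IHn _ _ _ mf'; have := nu_card h (S :\ x); have := matching_le_nu mf'.
  move=> h1 h2 IH; apply: colorable_leq (colorable_setD st1 (IH _)); lia.
have fxS := matching_in mf fx; have [_ hx] := matching_edge mf fx.
pose I := [set x; f x]; have stI : stable e I.
  apply/stableP => y z; rewrite !inE => /orP[]/eqP-> /orP[]/eqP->; rewrite ?e_irr //.
    exact: he.
  by rewrite e_sym; apply: he.
have mf' : matching h (S :\: I) (drop_pair f x).
  apply: (matching_restrict (matching_drop x mf)) => y.
  move=> fy; have [yS _] := matching_edge (matching_drop x mf) fy.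
  rewrite !inE yS andbT; move: fy; rewrite ffunE.
  by case: ifP; rewrite ?eqxx.
have cI : #|S| = #|S :\: I| + 2.
  have := cardsID I S; rewrite (setIidPr _) ?cards2 1?eq_sym ?fx; first by lia.
  by apply/subsetP => y; rewrite !inE => /orP[]/eqP->.
have := card_covered_drop mf fx => cc.
have := IHn _ _ _ mf'; have := nu_card h (S :\: I); have := matching_le_nu mf'.
move=> h1 h2 IH; apply: colorable_leq (colorable_setD stI (IH _)); lia.
Qed.

Lemma colorable_card S : colorable e S #|S|.
Proof.
have m0 : matching (fun _ _ => false) S [ffun x => x].
  by apply/matchingP; split=> x; rewrite !ffunE ?eqxx.
by apply: colorable_leq (colorable_matching _ m0); rewrite ?leq_subr.
Qed.

Section ChromaticBound.

Variables (g : nat -> nat) (M : nat).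
Hypothesis g_superadd : forall a b, a + b <= M -> g a + g b <= g (a + b).
Hypothesis g_step : forall m, m.+2 <= M -> g m < g m.+2.
Hypothesis ramsey_g : forall h : rel T,
  symmetric h -> irreflexive h -> (forall x y z, h x y -> h x z -> ~~ h y z) ->
  forall v (S : {set T}), v <= M -> #|S| = v.*2.+1 ->
  exists A : {set T}, [/\ A \subset S, stable h A & v < #|A| + g v].

(** [k.+1] is a lower bound for the chromatic number of [S], and [m] an upper bound for [#|S|] minus
    [k.+1]; working with bounds instead of exact values lets the induction pass to subsets. *)
Lemma clique_large S k m : m <= M -> ~ colorable e S k -> #|S| <= k.+1 + m ->
  exists A : {set T}, [/\ A \subset S, {in A &, forall x y, x != y -> e x y}
    & k < #|A| + g m].
Proof.
have [n] := ubnP #|S|; elim: n S k m => // n IHn S k m le_n mM ncol leS.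
have [/existsP[I /and3P[sI /eqP cI stI]]|/existsPn no3] :=
  boolP [exists I : {set T}, [&& I \subset S, #|I| == 3 & stable e I]].
  have cS := cardsID I S; rewrite (setIidPr sI) cI in cS.
  case: k ncol leS => [|k] ncol leS.
    have [x xS] : exists x, x \in S by apply/card_gt0P; lia.
    exists [set x]; rewrite sub1set xS cards1; split=> //.
    by move=> y z; rewrite !inE => /eqP-> /eqP->; rewrite eqxx.
  have ncol' : ~ colorable e (S :\: I) k.
    by move=> /(colorable_setD stI).
  (* [S :\: I] has more than [k] vertices, which forces [m >= 2]. Passing to it lowers the number of
     colours by one and [m] by two, and [g_step] makes up for the lost colour. *)
  have ltk : k < #|S :\: I|.
    by rewrite ltnNge; apply/negP => le; apply/ncol'/colorable_leq/colorable_card.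
  case: m mM leS => [|[|m]] mM leS; [by lia|by lia|].
  have [|||A [sA cA leA]] := IHn (S :\: I) k m _ _ ncol'; [by lia|by lia|by lia|].
  exists A; split=> //; first exact: subset_trans sA (subsetDl _ _).
  by have := g_step mM; lia.
pose h x y := [&& x \in S, y \in S, x != y & ~~ e x y].
have h_sym : symmetric h.
  by move=> x y; rewrite /h eq_sym e_sym; case: (x \in S); case: (y \in S).
have h_irr : irreflexive h by move=> x; rewrite /h eqxx !andbF.
have h_tri x y z : h x y -> h x z -> ~~ h y z.
  move=> /and4P[xS yS nxy exy] /and4P[_ zS nxz exz]; apply/negP => /and4P[_ _ nyz eyz].
  have /negP := no3 [set x; y; z]; apply; apply/and3P; split.
  - by apply/subsetP => t; rewrite !inE => /orP[/orP[]|]/eqP->.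
  - by rewrite setUC cardsU1 !inE cards2 nxy negb_or (eq_sym z x) (eq_sym z y) nxz nyz.
  apply/stableP => s t; rewrite !inE.
  by move=> /orP[/orP[]|]/eqP-> /orP[/orP[]|]/eqP->; rewrite ?e_irr // e_sym.
have [f mf ef] := nu_attained h S.
have he x y : h x y -> ~~ e x y by case/and4P.
(* Colouring along a maximum matching of the complement takes [#|S| - nu h S] colours; hence
   [nu h S <= m]. *)
have lt_k : k < #|S| - nu h S.
  rewrite ltnNge; apply/negP => le_k; apply: ncol; apply: colorable_leq le_k _.
  by have := colorable_matching he mf; rewrite ef mul2n doubleK.
have nu_m : nu h S <= m by lia.
have [|A [sA stA leA]] := stable_large h_sym h_irr g_superadd
    (ramsey_g h_sym h_irr h_tri) (S := S); first exact: leq_trans mM.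
exists A; split=> //.
  move=> x y xA yA nxy; have := stableP _ _ stA x y xA yA.
  by rewrite /h (subsetP sA x xA) (subsetP sA y yA) nxy /= negbK.
by have := superadd_mono g_superadd nu_m mM; lia.
Qed.

End ChromaticBound.

End Colorable.

(** * Vertex Folkman numbers *)

(** A 2-clique inside a part is a monochromatic edge. *)
Lemma varrow_nseq2 n (e : rel 'I_n) r :
  simple_graph e -> varrow e (nseq r 2) <-> ~ colorable e setT r.
Proof.
move=> [e_irr e_sym]; split=> [arr [c c_lt c_prop]|ncol c].
  have lt_c x : c x < size (nseq r 2) by rewrite size_nseq c_lt.
  have [i [A [cA]]] := arr (fun x => Ordinal (lt_c x)).
  have lt_i : i < r by have := ltn_ord i; rewrite [X in _ < X]size_nseq.
  rewrite nth_nseq lt_i => /eqP/cards2P[x [y [nxy defA]]] clA.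
  have xA : x \in A by rewrite defA !inE eqxx.
  have yA : y \in A by rewrite defA !inE eqxx orbT.
  have /negP := c_prop x y (in_setT _) (in_setT _) (clA x y xA yA nxy); apply.
  by apply/eqP; have := congr1 val (etrans (cA x xA) (esym (cA y yA))).
have [/existsP[x /existsP[y /andP[/eqP cxy exy]]]|/existsPn mono] :=
  boolP [exists x, exists y, (c x == c y) && e x y]; last first.
  case: ncol; exists (fun x => val (c x)) => [x _|x y _ _ exy].
    by have := ltn_ord (c x); rewrite [X in _ < X]size_nseq.
  apply: contraNneq (mono x) => /val_inj cxy; apply/existsP; exists y.
  by rewrite cxy eqxx.
have nxy : x != y by apply: contraTneq exy => ->; apply: e_irr.
exists (c x), [set x; y]; split=> [z||z t].
- by rewrite !inE => /orP[]/eqP->.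
- have := ltn_ord (c x); rewrite [X in _ < X]size_nseq nth_nseq => ->.
  by rewrite cards2 nxy.
rewrite !inE => /orP[]/eqP-> /orP[]/eqP->; rewrite ?eqxx //.
by rewrite e_sym.
Qed.

Lemma clique_lt_card n (e : rel 'I_n) q (A : {set 'I_n}) :
  clique_lt e q -> is_clique e A -> #|A| < q.
Proof.
move=> cl clA; rewrite ltnNge; apply/negP => /subset_of_card[B sB cB].
apply: cl; exists B; split=> // x y xB yB.
by apply: clA; apply: (subsetP sB).
Qed.

(* A bound on chi(G) - cl(G) in terms of |V(G)| - chi(G): any superadditive table
   with value 11 at 19 and 20, growing by at least 1 every 2 steps and satisfying
   R(3, v+1-gap v) <= 2v+1, would do. *)
Definition gap := nth 0
  [:: 0; 0; 1; 1; 2; 2; 3; 3; 4; 4; 5; 6; 7; 8; 8; 9; 9; 10; 10; 11; 11].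

Lemma gap_superadd a b : a + b <= 20 -> gap a + gap b <= gap (a + b).
Proof.
have /allP ok : all (fun a => all (fun b => (a + b <= 20) ==>
    (gap a + gap b <= gap (a + b))) (iota 0 21)) (iota 0 21) by vm_compute.
move=> ab; have [a_in b_in] : a \in iota 0 21 /\ b \in iota 0 21.
  by rewrite !mem_iota; lia.
by have /allP/(_ b b_in) := ok a a_in; rewrite ab.
Qed.

Lemma gap_step m : m.+2 <= 20 -> gap m < gap m.+2.
Proof.
have /allP ok : all (fun m => gap m < gap m.+2) (iota 0 19) by vm_compute.
by move=> m20; apply: ok; rewrite mem_iota.
Qed.

(** This says R(3, v+1-gap v) <= 2v+1 for v <= 19. The next case, v = 20, would be R(3,10) <= 41,
    the hypothesis separating the two parts of the theorem. *)
Lemma gap_certified : all (fun v => has (fun e : entry =>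
    [&& e.1.1.1 + gap v == v.+1, e.1.1.2 <= v.*2.+1 & e.1.2 == 1000])
  ramsey_cert) (iota 0 20).
Proof. by vm_compute. Qed.

(** * Stable sets from Ramsey bounds *)

Section StableSets.

Variables (T : finType) (h : rel T).
Hypothesis h_sym : symmetric h.
Hypothesis h_irr : irreflexive h.
Hypothesis h_tri : forall x y z, h x y -> h x z -> ~~ h y z.

Lemma not_alpha_lt (S : {set T}) k : ~ alpha_lt h S k ->
  exists A : {set T}, [/\ A \subset S, stable h A & k <= #|A|].
Proof.
move=> na; apply: NNPP => nex; apply: na => A sA stA.
by rewrite ltnNge; apply/negP => le; apply: nex; exists A.
Qed.

Lemma stable_gap v (S : {set T}) : v <= 19 -> #|S| = v.*2.+1 ->
  exists A : {set T}, [/\ A \subset S, stable h A & v < #|A| + gap v].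
Proof.
move=> v19 cS; have v_in : v \in iota 0 20 by rewrite mem_iota.
have /hasP[[[[k n] b] l] e_in /= /and3P[/eqP ek en /eqP eb]] := allP gap_certified v v_in.
have [|A [sA stA leA]] := @not_alpha_lt S k; last first.
  by exists A; split=> //; rewrite -ek leq_add2r.
move=> aS; have := certified_degsum_ge h_sym h_irr h_tri ramsey_certified e_in.
move=> /(_ S) /=; rewrite cS eb => /(_ en aS) big.
(* The degree sum of [S] is at most (2v+1)(v+1) <= 780, so it cannot reach 1000. *)
have aS' : alpha_lt h S v.+2 by move=> A sA stA; have := aS A sA stA; lia.
by have := degsum_le h_tri aS'; rewrite cS; nia.
Qed.

Lemma stable_of_ramsey p (S : {set T}) N :
  ramsey_le p 3 N -> N <= #|S| ->
  exists A : {set T}, [/\ A \subset S, stable h A & #|A| = p].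
Proof.
(* [e] is the complement of [h] on [S]: its cliques are stable for [h], and its independent triples
   would be triangles of [h]. *)
move=> ram leS; pose e (i j : 'I_#|S|) := (i != j) && ~~ h (enum_val i) (enum_val j).
have se : simple_graph e.
  by split=> [x|x y]; rewrite /e ?eqxx // eq_sym h_sym.
have [[A [cA clA]]|[A [cA inA]]] := ram _ leS e se.
  exists (enum_val @: A); split.
  - by apply/subsetP => _ /imsetP[i _ ->]; apply: enum_valP.
  - apply/stableP => _ _ /imsetP[i iA ->] /imsetP[j jA ->].
    have [->|nij] := eqVneq i j; first by rewrite h_irr.
    by have /andP[] := clA i j iA jA nij.
  by rewrite card_imset //; apply: enum_val_inj.
have /card_gt2P[x [y [z [[xA yA zA] [nxy nyz nzx]]]]] : 2 < #|A| by rewrite cA.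
have edge i j : i \in A -> j \in A -> i != j -> h (enum_val i) (enum_val j).
  by move=> iA jA nij; have := inA i j iA jA nij; rewrite /e nij negbK.
have := h_tri (edge x y xA yA nxy) (edge x z xA zA _).
by rewrite eq_sym nzx edge // => /(_ isT).
Qed.

End StableSets.

(** With at most [r + M.+1] vertices, a graph that is not [r]-colourable has a clique on more than
    [r - 11] vertices, because [gap M = 11]. For [M = 19] the certified bounds suffice; [M = 20]
    also takes R(10,3) <= 41. *)
Lemma Fv_ge_gap r M : 13 <= r -> 19 <= M <= 20 ->
    (M = 20 -> ramsey_le 10 3 41) ->
  Fv_ge (nseq r 2) (r - 10) (r + M.+2).
Proof.
move=> r13 /andP[M19 M20] ram n e [se /(varrow_nseq2 _ se) ncol cl].
have [e_irr e_sym] := se.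
rewrite leqNgt; apply/negP => lt_n.
have e_irr' : irreflexive e by move=> x; apply/negbTE/e_irr.
have gapM : gap M = 11 by have [->|->] : M = 19 \/ M = 20 by lia.
have [||||A [_ clA ltA]] :=
  @clique_large _ e e_sym e_irr' gap M _ _ _ setT r M (leqnn _) ncol.
- by move=> a b ab; apply: gap_superadd; apply: leq_trans M20.
- by move=> m mM; apply: gap_step; apply: leq_trans M20.
- move=> h h_sym h_irr h_tri v S vM cS.
  have [v19|v20] := leqP v 19; first exact: stable_gap.
  have eM : M = 20 by lia.
  have ev : v = 20 by lia.
  have [|A [sA stA cA]] := stable_of_ramsey h_sym h_irr h_tri (ram eM) (S := S).
    by rewrite cS ev.
  by exists A; rewrite cA ev.
- by rewrite cardsT card_ord; lia.
rewrite gapM in ltA.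
have lt1 : #|A| < r - 10 := clique_lt_card cl clA.
have lt2 : r < #|A| + 11 := ltA.
by move: r13 lt1 lt2; clear; lia.
Qed.

(** * Graphs attaining the bounds *)

Lemma inHv_universal n (e : rel 'I_n) r q : inHv e (nseq r 2) q ->
  exists e' : rel 'I_n.+1, inHv e' (nseq r.+1 2) q.+1.
Proof.
move=> [se /(varrow_nseq2 _ se) ncol cl]; have [e_irr e_sym] := se.
pose e' (x y : 'I_n.+1) := match unlift ord0 x, unlift ord0 y with
  | Some a, Some b => e a b | None, None => false | _, _ => true end.
have e'l x y : e' (lift ord0 x) (lift ord0 y) = e x y by rewrite /e' !liftK.
have e'0 x : e' ord0 (lift ord0 x) by rewrite /e' liftK unlift_none.
have se' : simple_graph e'.
  split=> [x|x y]; rewrite /e'; first by case: (unlift _ x) => // a; apply: e_irr.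
  by case: (unlift _ x); case: (unlift _ y).
exists e'; split=> //.
  apply/(varrow_nseq2 _ se') => -[c c_lt c_prop]; apply: ncol.
  have c0 x : c ord0 != c (lift ord0 x) by apply: c_prop.
  (* Colour [r] is freed: vertices having it take the colour of [ord0], which no other vertex uses
     because [ord0] is universal. *)
  pose d x := if c (lift ord0 x) == r then c ord0 else c (lift ord0 x).
  exists d => [x _|x y _ _ exy]; rewrite /d.
    have lt_x := c_lt (lift ord0 x) (in_setT _); have lt_0 := c_lt ord0 (in_setT _).
    have := c0 x; case: (c (lift ord0 x) =P r) => [->|]; move: lt_x lt_0; clear; lia.
  have := c_prop (lift ord0 x) (lift ord0 y) (in_setT _) (in_setT _).
  rewrite e'l => /(_ exy); have := c0 x; have := c0 y.
  case: (c (lift ord0 x) =P r) => [->|_]; case: (c (lift ord0 y) =P r) => [->|_] //.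
    by rewrite eqxx.
  by move=> _ c0x _; rewrite eq_sym.
move=> [A [cA clA]]; pose B := [set x | lift ord0 x \in A].
have clB : is_clique e B.
  by move=> x y; rewrite !inE => xA yA nxy; rewrite -e'l; apply: clA.
have := clique_lt_card cl clB; rewrite ltnNge => /negP; apply.
rewrite -ltnS -cA; have sA : A \subset ord0 |: (lift ord0 @: B).
  apply/subsetP => x xA; rewrite !inE.
  have [a ex|->] := unliftP ord0 x; last by rewrite eqxx.
  by rewrite orbC ex imset_f // inE -ex.
apply: leq_trans (subset_leq_card sA) _; rewrite cardsU1 -[leqRHS]add1n.
by apply: leq_add; [case: (_ \notin _) | apply: leq_imset_card].
Qed.

(** A colour class is stable, so it has at most two vertices. *)
Lemma colorable_card_le (T : finType) (e : rel T) (S : {set T}) k :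
  alpha_lt e S 3 -> colorable e S k -> #|S| <= k.*2.
Proof.
elim: k S => [|k IHk] S aS [c c_lt c_prop].
  by rewrite leqn0 cards_eq0; apply/set0Pn => -[x /c_lt].
pose I := [set x in S | c x == k].
have sI : I \subset S by apply/subsetP => x; rewrite inE => /andP[].
have cI : #|I| < 3.
  apply: aS => //; apply/stableP => x y; rewrite !inE.
  move=> /andP[xS /eqP cx] /andP[yS /eqP cy]; apply/negP => exy.
  by have := c_prop x y xS yS exy; rewrite cx cy eqxx.
have cD := cardsID I S; rewrite (setIidPr sI) in cD.
have : #|S :\: I| <= k.*2.
  apply: IHk; first exact: alpha_ltS (subsetDl _ _) aS.
  exists c => [x|x y]; rewrite !inE => /andP[].
    move=> /[swap] xS; rewrite xS /= => cx; have := c_lt x xS.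
    by rewrite ltnS leq_eqVlt (negPf cx).
  by move=> _ xS /andP[_ yS]; apply: c_prop.
by move: cD cI; rewrite doubleS; clear; lia.
Qed.

(* Joining with a complete graph K_s raises both the chromatic and the clique
   number by s. *)
Lemma inHv_alpha2 t q s (e : rel 'I_(t.*2.+1)) :
    simple_graph e -> clique_lt e q ->
    ~ (exists A : {set 'I_(t.*2.+1)}, #|A| = 3 /\ is_indep e A) ->
  exists e' : rel 'I_(t.*2.+1 + s), inHv e' (nseq (t + s) 2) (q + s).
Proof.
move=> se cl no3; elim: s => [|s [e1 /inHv_universal]]; last by rewrite !addnS.
rewrite !addn0; exists e; split=> //; apply/(varrow_nseq2 _ se) => col.
(* [t] classes of at most two vertices cannot cover [t.*2.+1] vertices. *)
suff aT : alpha_lt e setT 3.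
  by have := colorable_card_le aT col; rewrite cardsT card_ord ltnn.
move=> A _ /stableP stA; rewrite ltnNge; apply/negP => /subset_of_card[B sB cB].
apply: no3; exists B; split=> // x y xB yB _.
by apply: stA; apply: (subsetP sB).
Qed.

(** A counterexample on at least [N] vertices stays one when restricted to its first [N]
    vertices. *)
Lemma not_ramsey_le p q N : ~ ramsey_le p q N ->
  exists e : rel 'I_N, [/\ simple_graph e, clique_lt e p &
    ~ (exists A : {set 'I_N}, #|A| = q /\ is_indep e A)].
Proof.
move=> nram; apply: NNPP => nex; apply: nram => m le_N e [e_irr e_sym].
apply: NNPP => /not_or_and[nclq nind]; apply: nex.
pose w := widen_ord le_N; have w_inj : injective w by move=> x y [] /val_inj.
exists (fun x y => e (w x) (w y)); split.
- by split.
- move=> [A [cA clA]]; apply: nclq; exists (w @: A); rewrite card_imset //.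
  split=> // _ _ /imsetP[x xA ->] /imsetP[y yA ->]; rewrite (inj_eq w_inj).
  exact: clA.
move=> [A [cA inA]]; apply: nind; exists (w @: A); rewrite card_imset //.
split=> // _ _ /imsetP[x xA ->] /imsetP[y yA ->]; rewrite (inj_eq w_inj).
exact: inA.
Qed.

(** * A circulant graph on Z/43, checked by exhaustive search *)

Section StableSearch.

Variable pat : bitseq.

Fixpoint mask_and (s t : bitseq) : bitseq :=
  match s, t with
  | x :: s', y :: t' => (if x then y else false) :: mask_and s' t'
  | _, _ => [::]
  end.

(* Candidates are stored relative to the first one, so that adjacency in a
   circulant graph becomes the fixed mask [pat]. Nested conditionals rather than
   boolean connectives keep call-by-value evaluation from exploring dead
   branches. *)
Fixpoint stable_search fuel k (m : bitseq) :=
  if k is k'.+1 then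
    if k <= count id m then
      match fuel, m with
      | fuel'.+1, b :: m' =>
          if (if b then stable_search fuel' k' (mask_and m' pat) else false)
          then true else stable_search fuel' k m'
      | _, _ => false
      end
    else false
  else true.

Lemma nth_mask_and s t i :
  nth false (mask_and s t) i = nth false s i && nth false t i.
Proof.
elim: s t i => [|x s IHs] [|y t] [|i] //=; rewrite ?nth_nil ?andbF //.
Qed.

Lemma count_nth_le (a m : bitseq) :
  (forall i, nth false a i -> nth false m i) -> count id a <= count id m.
Proof.
elim: a m => [|x a IHa] m le_am //=.
have : count id a <= count id (behead m).
  by apply: IHa => i ai; rewrite nth_behead; apply: (le_am i.+1).
have := le_am 0; case: m {le_am} => [|y m] /=; first by case: x => // /(_ isT).
by case: x => [/(_ isT)->|_]; lia.
Qed.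

(** [a] is the indicator of a large stable set among the candidates [m]; the path selecting its true
    positions is never pruned, so the search succeeds. Bit [j] of [pat] stands for the difference
    [j.+1]. *)
Lemma stable_searchP fuel k (a m : bitseq) :
    size m <= fuel -> (forall i, nth false a i -> nth false m i) ->
    (forall i j, nth false a i -> nth false a (i + j).+1 -> nth false pat j) ->
    k <= count id a ->
  stable_search fuel k m.
Proof.
elim: fuel k a m => [|fuel IH] [|k] a m //= sz le_am a_pat ka.
  have := count_nth_le le_am; case: m sz {le_am} => //= _.
  by rewrite leqn0 => /eqP ca; rewrite ca in ka.
rewrite (leq_trans ka (count_nth_le le_am)).
case: m a sz le_am a_pat ka => [|b m] [|x a] //= sz le_am a_pat ka.
  have := count_nth_le le_am => /=; lia.
have tail_le i : nth false a i -> nth false m i by apply: (le_am i.+1).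
have tail_pat i j : nth false a i -> nth false a (i + j).+1 -> nth false pat j.
  by apply: (a_pat i.+1 j).
have sz_and t : size (mask_and m t) <= fuel.
  apply: leq_trans (_ : size m <= _); last by [].
  by elim: (m) t => [|y s IHs] [|z t] //=; rewrite ltnS.
case: x le_am a_pat ka => /= le_am a_pat ka; last first.
  by rewrite (IH k.+1 a m) // if_same.
have -> : b = true := le_am 0 isT.
rewrite (IH k a (mask_and m pat)) // => i ai.
by rewrite nth_mask_and tail_le //=; apply: (a_pat 0 i).
Qed.

End StableSearch.

(** The connection set {±1, ±4, ±6, ±9, ±20} modulo 43, closed under negation and sum-free. Its
    circulant graph shows R(3,11) > 43. *)
Definition circ_diffs := [:: 1; 4; 6; 9; 20; 23; 34; 37; 39; 42].

(* Truncated subtraction makes one of the two differences 0. *)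
Definition circ (x y : 'I_43) := (x - y \in circ_diffs) || (y - x \in circ_diffs).
Definition cocirc (x y : 'I_43) := (x != y) && ~~ circ x y.

Lemma cocirc_simple : simple_graph cocirc.
Proof.
split=> [x|x y]; first by rewrite /cocirc eqxx.
by rewrite /cocirc /circ eq_sym orbC.
Qed.

Lemma circ_sum_free d1 d2 :
  d1 \in circ_diffs -> d2 \in circ_diffs ->
  [/\ 0 < d1, 0 < d2 & d1 + d2 \notin circ_diffs].
Proof.
have /allP ok : all (fun d1 => all (fun d2 =>
    [&& 0 < d1, 0 < d2 & d1 + d2 \notin circ_diffs]) circ_diffs) circ_diffs.
  by vm_compute.
by move=> in1 in2; have /allP/(_ d2 in2)/and3P := ok d1 in1.
Qed.

(** Among three integers one pairwise distance is the sum of the other two, so sum-freeness over the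
    integers is enough. *)
Lemma circ_triangle_free x y z : circ x y -> circ y z -> ~~ circ z x.
Proof.
have no a b c : a \in circ_diffs -> b \in circ_diffs -> c \in circ_diffs ->
    ~~ [|| a + b == c, a + c == b, b + c == a | (a == 0) || (b == 0)].
  move=> ha hb hc; have [a0 b0 ab] := circ_sum_free ha hb.
  have [_ _ ac] := circ_sum_free ha hc; have [_ _ bc] := circ_sum_free hb hc.
  rewrite !negb_or -!lt0n a0 b0 !andbT.
  by apply/and3P; split; [apply: contraNneq ab | apply: contraNneq ac
    | apply: contraNneq bc] => ->.
move=> /orP[]xy /orP[]yz; apply/negP => /orP[]zx; have := no _ _ _ xy yz zx;
  have [] := circ_sum_free xy yz; have [] := circ_sum_free zx zx; clear; lia.
Qed.

Lemma cocirc_alpha :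
  ~ (exists A : {set 'I_43}, #|A| = 3 /\ is_indep cocirc A).
Proof.
move=> [A [cA inA]].
have /card_gt2P[x [y [z [[xA yA zA] [nxy nyz nzx]]]]] : 2 < #|A| by rewrite cA.
have edge i j : i \in A -> j \in A -> i != j -> circ i j.
  by move=> iA jA nij; have := inA i j iA jA nij; rewrite /cocirc nij negbK.
have /negP := circ_triangle_free (edge _ _ xA yA nxy) (edge _ _ yA zA nyz).
by apply; apply: edge.
Qed.

Definition circ_pattern := Eval vm_compute in [seq d \notin circ_diffs | d <- iota 1 42].

Lemma circ_search : stable_search circ_pattern 43 11 (nseq 43 true) = false.
Proof. by vm_compute. Qed.

Lemma cocirc_clique_lt : clique_lt cocirc 11.
Proof.
(* [a] records membership in [A] along 0, ..., 42; an 11-clique would make the search succeed,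
   against [circ_search]. *)
move=> [A [cA clA]]; pose a := [seq x \in A | x <- enum 'I_43].
have sa : size a = 43 by rewrite size_map size_enum_ord.
have nth_a i : nth false a i -> exists2 x : 'I_43, x \in A & i = x.
  have [ge|lt] := leqP 43 i; first by rewrite nth_default ?sa.
  rewrite (nth_map ord0) ?size_enum_ord // => iA.
  by exists (nth ord0 (enum 'I_43) i) => //; rewrite nth_enum_ord.
have /negP := negbT circ_search; apply; apply: (@stable_searchP _ _ _ a).
- by rewrite size_nseq.
- by move=> i /nth_a[x _ ->]; rewrite nth_nseq ltn_ord.
- move=> i j /nth_a[x xA ->] /nth_a[y yA exy].
  have nxy : x != y by apply/eqP => ex; move: exy; rewrite ex; lia.
  have /andP[_] := clA x y xA yA nxy; rewrite negb_or => /andP[_].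
  have -> : y - x = j.+1 by lia.
  have lt_j : j < 42 by have := ltn_ord y; lia.
  have -> : circ_pattern = [seq d \notin circ_diffs | d <- iota 1 42] by [].
  by rewrite (nth_map 0) ?size_iota // nth_iota.
suff -> : count id a = #|A| by rewrite cA.
by rewrite count_map cardE enumT /enum_mem size_filter; apply: eq_count.
Qed.

Theorem theorem1p3 (r : nat) (hr : 13 <= r) :
  (Fv_ge (nseq r 2) (r - 10) (r + 21) /\
   (~ ramsey_le 10 3 41 -> 20 <= r -> Fv_eq (nseq r 2) (r - 10) (r + 21))) /\
  (ramsey_le 10 3 41 ->
   Fv_ge (nseq r 2) (r - 10) (r + 22) /\
   (21 <= r -> Fv_eq (nseq r 2) (r - 10) (r + 22))).
Proof.
have ge21 : Fv_ge (nseq r 2) (r - 10) (r + 21) by apply: (@Fv_ge_gap r 19).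
split; first split=> // nram r20.
  split=> //; have [e [se cl no3]] := not_ramsey_le nram.
  (* A Ramsey counterexample on 41 = 2 * 20 + 1 vertices, joined with a complete graph on [r - 20]
     vertices. *)
  have := @inHv_alpha2 20 10 (r - 20) e se cl no3.
  have -> : 20.*2.+1 + (r - 20) = r + 21 by lia.
  have -> : 20 + (r - 20) = r by lia.
  by have -> : 10 + (r - 20) = r - 10 by lia.
move=> ram; have ge22 : Fv_ge (nseq r 2) (r - 10) (r + 22).
  exact: (@Fv_ge_gap r 20).
split=> // r21; split=> //.
(* The circulant complement on 43 = 2 * 21 + 1 vertices, joined with a complete graph on [r - 21]
   vertices. *)
have := @inHv_alpha2 21 11 (r - 21) cocirc cocirc_simple cocirc_clique_lt cocirc_alpha.
have -> : 21.*2.+1 + (r - 21) = r + 22 by lia.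
have -> : 21 + (r - 21) = r by lia.
by have -> : 11 + (r - 21) = r - 10 by lia.
Qed.
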